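(* Let $f$ satisfy (f1) and suppose $f_0=0$ and $f_\infty\in(0,+\infty)$. Then for every $\lambda\in(\lambda_1/f_\infty,+\infty)$, problem (MO) has two solutions $u^+$ and $u^-$ such that $u^+$ is positive and strictly concave in $(0,1)$ and $u^-$ is negative and strictly convex in $(0,1)$.
   Context: Let $N\ge 1$ be an integer and $f:\mathbb{R}\to\mathbb{R}$ continuous. For $\lambda\ge 0$, problem (MO) is: find $u\in C^2[0,1]$ with $\left((u'(r))^N\right)'=\lambda^N N r^{N-1} f(-u(r))$ for $0<r<1$ and $u'(0)=u(1)=0$. Condition (f1): $f\in C(\mathbb{R},\mathbb{R})$ and $f(s)s^N>0$ for all $s\neq0$. The quantities $f_0,f_\infty\in[0,+\infty]$ are defined by $f_0^N=\lim_{s\to0} f(s)/s^N$ and $f_\infty^N=\lim_{|s|\to+\infty} f(s)/s^N$ (limits assumed to exist in $[0,+\infty]$). $\lambda_1>0$ denotes the first eigenvalue of $\left((-v')^N\right)'=\lambda^N N r^{N-1}v^N$ in $(0,1)$, $v'(0)=v(1)=0$, i.e. the unique $\lambda>0$ for which this problem has a solution $v\in C^2[0,1]$ positive in $(0,1)$. *)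

(* Defs.v *)
From Stdlib Require Import Reals Lra.
Open Scope R_scope.

(* g' is the derivative of g on the closed interval [0,1]
   (one-sided at the endpoints: difference quotients taken within [0,1]). *)
Definition deriv_on01 (g g' : R -> R) : Prop :=
  forall x, 0 <= x <= 1 ->
  forall eps, 0 < eps -> exists delta, 0 < delta /\
    forall y, 0 <= y <= 1 -> y <> x -> Rabs (y - x) < delta ->
      Rabs ((g y - g x) / (y - x) - g' x) < eps.

Definition cont_on01 (g : R -> R) : Prop :=
  forall x, 0 <= x <= 1 ->
  forall eps, 0 < eps -> exists delta, 0 < delta /\
    forall y, 0 <= y <= 1 -> Rabs (y - x) < delta -> Rabs (g y - g x) < eps.

Definition C2_01 (u u1 u2 : R -> R) : Prop :=
  deriv_on01 u u1 /\ deriv_on01 u1 u2 /\ cont_on01 u2.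

Definition solves_MO (N : nat) (f : R -> R) (lam : R) (u : R -> R) : Prop :=
  exists u1 u2, C2_01 u u1 u2 /\
    (forall r, 0 < r < 1 ->
       derivable_pt_lim (fun s => (u1 s) ^ N) r
         (lam ^ N * INR N * r ^ (N - 1) * f (- u r))) /\
    u1 0 = 0 /\ u 1 = 0.

Definition pos_eigenfunction (N : nat) (lam : R) (v : R -> R) : Prop :=
  exists v1 v2, C2_01 v v1 v2 /\
    (forall r, 0 < r < 1 ->
       derivable_pt_lim (fun s => (- v1 s) ^ N) r
         (lam ^ N * INR N * r ^ (N - 1) * (v r) ^ N)) /\
    v1 0 = 0 /\ v 1 = 0 /\
    (forall r, 0 < r < 1 -> 0 < v r).

Definition first_eigenvalue (N : nat) (lam1 : R) : Prop :=
  0 < lam1 /\ (exists v, pos_eigenfunction N lam1 v) /\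
  (forall lam, 0 < lam -> (exists v, pos_eigenfunction N lam v) -> lam = lam1).

Definition strictly_concave01 (u : R -> R) : Prop :=
  forall x y t, 0 < x < 1 -> 0 < y < 1 -> x <> y -> 0 < t < 1 ->
    t * u x + (1 - t) * u y < u (t * x + (1 - t) * y).

Definition strictly_convex01 (u : R -> R) : Prop :=
  forall x y t, 0 < x < 1 -> 0 < y < 1 -> x <> y -> 0 < t < 1 ->
    u (t * x + (1 - t) * y) < t * u x + (1 - t) * u y.

Definition lim_at_0_ratio (N : nat) (f : R -> R) (L : R) : Prop :=
  forall eps, 0 < eps -> exists delta, 0 < delta /\
    forall s, s <> 0 -> Rabs s < delta -> Rabs (f s / s ^ N - L) < eps.

Definition lim_at_inf_ratio (N : nat) (f : R -> R) (L : R) : Prop :=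
  forall eps, 0 < eps -> exists M, 0 < M /\
    forall s, M < Rabs s -> Rabs (f s / s ^ N - L) < eps.

(* Main.v *)
Require Import Defs.
From Stdlib Require Import Reals Lra Lia Ranalysis5.
From Coquelicot Require Import Coquelicot.
Open Scope R_scope.

(* Write N = n+1. With the height w as independent variable the radial problem
   (-w')^N = int_0^r N t^n h(w(t)) dt, w(0) = 1, becomes a fixed-point problem for the
   inverse function r(w). The substitution w = 1 - x^2, r = x e^{p(x)} removes the
   singularity at the top and turns it into
     M(x)       = 2 (n+2) int_0^1 e^{n p(xt)} h(1 - (xt)^2) t^{n+1} dt,
     e^{p(x)}   = 2 int_0^1 M(xt)^{-1/(n+2)} dt,  0 <= x <= 1.
   The right-hand side is homogeneous of degree -n/(n+2) in e^p and antitone, hence a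
   contraction in the sup norm of p (Thompson's metric). So although h is merely
   continuous, the fixed point p_h exists and p_h(1) depends continuously on h; the
   corresponding w vanishes exactly at the radius e^{p_h(1)}.
   A solution of amplitude a corresponds to h_a(s) = lam^N |f(+-a s)| / a^N and radius 1.
   As a -> 0, h_a -> 0 and the radius exceeds 1; as a -> oo, h_a tends uniformly on [0,1]
   to (lam finf s)^N, whose radius R satisfies R^2 lam finf = lam1, hence R < 1. The
   intermediate value theorem yields an amplitude with radius exactly 1. *)

(** * Continuity of real functions and of integrals with a parameter *)

Lemma Rcontinuous_mult (f g : R -> R) (x : R) :
  continuous f x -> continuous g x -> continuous (fun y => f y * g y) x.
Proof. exact (continuous_mult f g x). Qed.

Lemma Rcontinuous_opp (f : R -> R) (x : R) :
  continuous f x -> continuous (fun y => - f y) x.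
Proof. exact (continuous_opp f x). Qed.

Lemma Rcontinuous_minus (f g : R -> R) (x : R) :
  continuous f x -> continuous g x -> continuous (fun y => f y - g y) x.
Proof. exact (continuous_minus f g x). Qed.

Lemma Rcontinuous_pow (f : R -> R) (k : nat) (x : R) :
  continuous f x -> continuous (fun y => f y ^ k) x.
Proof.
  intros Hf; induction k as [|k IH]; simpl.
  - apply continuous_const.
  - now apply Rcontinuous_mult.
Qed.

Lemma Rcontinuous_exp (f : R -> R) (x : R) :
  continuous f x -> continuous (fun y => exp (f y)) x.
Proof.
  intros Hf; apply (continuous_comp f exp); auto.
  apply continuity_pt_filterlim, derivable_continuous_pt, derivable_pt_exp.
Qed.

Lemma Rcontinuous_ln (f : R -> R) (x : R) :
  0 < f x -> continuous f x -> continuous (fun y => ln (f y)) x.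
Proof.
  intros Hp Hf; apply (continuous_comp f ln); auto.
  apply (@ex_derive_continuous R_AbsRing R_NormedModule).
  exists (/ f x); now apply is_derive_Reals, derivable_pt_lim_ln.
Qed.

Lemma Rcontinuous_inv (f : R -> R) (x : R) :
  f x <> 0 -> continuous f x -> continuous (fun y => / f y) x.
Proof. intros Hp Hf; now apply continuous_Rinv_comp. Qed.

Ltac cont :=
  repeat (try assumption; lazymatch goal with
    | |- continuous (fun _ => ?c) _ => apply continuous_const
    | |- continuous (fun y => y) _ => apply continuous_id
    | |- continuous (fun y => _ - _) _ => apply Rcontinuous_minus
    | |- continuous (fun y => _ * _) _ => apply Rcontinuous_mult
    | |- continuous (Rmult ?c) _ => apply (Rcontinuous_mult (fun _ => c) (fun y => y))
    | |- continuous (fun y => _ ^ _) _ => apply Rcontinuous_pow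
    | |- continuous (fun y => exp _) _ => apply Rcontinuous_exp
    end).

Lemma continuous_maximum (f : R -> R) :
  (forall x, continuous f x) ->
  exists x0, 0 <= x0 <= 1 /\ forall x, 0 <= x <= 1 -> f x <= f x0.
Proof.
  intros Hf.
  destruct (continuity_ab_maj f 0 1) as [x0 [H1 H2]]; [lra| |].
  - intros c _; apply continuity_pt_filterlim, Hf.
  - exists x0; auto.
Qed.

Lemma ex_RInt_of_continuous (f : R -> R) (a b : R) :
  (forall x, continuous f x) -> ex_RInt f a b.
Proof. intros Hf; apply (@ex_RInt_continuous R_CompleteNormedModule); auto. Qed.

(** Compactness of the segment {x0} x [0,1] makes the joint continuity uniform along it, so for [y]
    near [x0] the two integrands differ by at most [eps/2] on all of [0,1]. *)
Lemma continuous_RInt_param (f : R -> R -> R) (x0 : R) :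
  (forall x t, continuity_2d_pt f x t) ->
  continuous (fun x => RInt (f x) 0 1) x0.
Proof.
  intros Hf.
  assert (Hc : forall x t, continuous (f x) t).
  { intros x t; apply continuity_pt_filterlim; intros eps Heps.
    destruct (Hf x t (mkposreal eps Heps)) as [d Hd].
    exists d; split; [apply cond_pos|].
    intros y [_ Hy]; apply Hd; [|exact Hy].
    rewrite Rminus_diag, Rabs_R0; apply cond_pos. }
  apply filterlim_locally; intros eps.
  destruct (uniform_continuity_2d_1d' f 0 1 x0 (fun t _ => Hf x0 t)
              (pos_div_2 eps)) as [d Hd].
  exists d; intros y Hy.
  change (Rabs (y - x0) < d) in Hy; apply Rabs_def2 in Hy.
  assert (E : forall t, 0 <= t <= 1 -> Rabs (f y t - f x0 t) <= pos_div_2 eps).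
  { intros t Ht; apply Rlt_le, Hd; rewrite ?Rminus_diag, ?Rabs_R0;
      generalize (cond_pos d); lra. }
  change (Rabs (RInt (f y) 0 1 - RInt (f x0) 0 1) < eps).
  rewrite <- (RInt_minus (V := R_CompleteNormedModule) (f y) (f x0));
    try (apply ex_RInt_of_continuous; auto).
  apply Rle_lt_trans with ((1 - 0) * pos_div_2 eps).
  - apply abs_RInt_le_const; [lra| |auto].
    apply ex_RInt_of_continuous; intros t; apply (continuous_minus (f y) (f x0)); auto.
  - simpl; generalize (cond_pos eps); lra.
Qed.

(** * Truncation to [0,1] and dilated integrals *)

Definition clamp (x : R) : R := Rmax 0 (Rmin x 1).

Lemma clamp_bounds (x : R) : 0 <= clamp x <= 1.
Proof.
  unfold clamp, Rmax, Rmin; repeat destruct (Rle_dec _ _); lra.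
Qed.

Lemma clamp_id (x : R) : 0 <= x <= 1 -> clamp x = x.
Proof. intros [? ?]; unfold clamp; rewrite Rmin_left, Rmax_right; lra. Qed.

Lemma continuous_clamp (x : R) : continuous clamp x.
Proof.
  apply filterlim_locally; intros eps; exists eps; intros y Hy.
  change (Rabs (clamp y - clamp x) < eps).
  apply Rle_lt_trans with (2 := Hy).
  change (Rabs (clamp y - clamp x) <= Rabs (y - x)).
  unfold clamp, Rmax, Rmin.
  repeat destruct (Rle_dec _ _); unfold Rabs; repeat destruct (Rcase_abs _); lra.
Qed.

Lemma continuous_clamp_comp (f : R -> R) (x : R) :
  (forall y, 0 <= y <= 1 -> continuous f y) -> continuous (fun y => f (clamp y)) x.
Proof.
  intros Hf; apply (continuous_comp clamp f); [apply continuous_clamp|].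
  apply Hf, clamp_bounds.
Qed.

Lemma continuity_2d_pt_dilation (F G : R -> R) (x t : R) :
  (forall y, continuous F y) -> (forall y, continuous G y) ->
  continuity_2d_pt (fun x t => F (x * t) * G t) x t.
Proof.
  intros HF HG; apply continuity_2d_pt_mult.
  - apply (continuity_1d_2d_pt_comp F (fun x t => x * t)).
    + apply continuity_pt_filterlim, HF.
    + apply continuity_2d_pt_mult;
        [apply continuity_2d_pt_id1 | apply continuity_2d_pt_id2].
  - apply (continuity_1d_2d_pt_comp G (fun x t => t)).
    + apply continuity_pt_filterlim, HG.
    + apply continuity_2d_pt_id2.
Qed.

Lemma continuous_RInt_dilation (F G : R -> R) (x : R) :
  (forall y, continuous F y) -> (forall y, continuous G y) ->
  continuous (fun x => RInt (fun t => F (x * t) * G t) 0 1) x.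
Proof.
  intros HF HG; apply continuous_RInt_param; intros; now apply continuity_2d_pt_dilation.
Qed.

(** * Fixed points of contractions in the sup norm on [0,1] *)

Definition iterate (Op : (R -> R) -> R -> R) (k : nat) : R -> R :=
  Nat.iter k Op (fun _ => 0).

(* [clamp] makes the limit depend only on the values on [0,1] while defining it on
   all of R, where two-sided continuity can be used. *)
Definition fixpoint (Op : (R -> R) -> R -> R) (x : R) : R :=
  real (Lim_seq (fun k => iterate Op k (clamp x))).

Section Contraction.

Variables (Op : (R -> R) -> R -> R) (theta : R).
Hypothesis theta_bounds : 0 <= theta < 1.
Hypothesis Op_continuous :
  forall p, (forall x, continuous p x) -> forall x, continuous (Op p) x.
Hypothesis Op_contraction :
  forall p q d, (forall x, continuous p x) -> (forall x, continuous q x) ->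
  (forall x, 0 <= x <= 1 -> Rabs (p x - q x) <= d) ->
  forall x, Rabs (Op p x - Op q x) <= theta * d.

Lemma iterate_continuous (k : nat) (x : R) : continuous (iterate Op k) x.
Proof.
  revert x; induction k as [|k IH]; intros x; simpl.
  - apply continuous_const.
  - now apply Op_continuous.
Qed.

(** With [C] the maximum over [0,1] of the absolute value of the first iterate, the bound
    [C / (1 - theta)] reproduces itself under one more step, since [theta * (C / (1 - theta)) + C =
    C / (1 - theta)]; this is the case [k = 0]. Each further application of [Op] to both iterates
    gains a factor [theta]. *)
Lemma iterate_geometric :
  exists C, 0 <= C /\ forall k m x, 0 <= x <= 1 ->
    Rabs (iterate Op (k + m) x - iterate Op k x) <= C * theta ^ k.
Proof.
  destruct (continuous_maximum (fun x => Rabs (iterate Op 1 x))) as [x0 [_ Hx0]].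
  { intros x; apply (continuous_Rabs_comp (iterate Op 1)), iterate_continuous. }
  set (C := Rabs (iterate Op 1 x0)).
  assert (HC : 0 <= C) by apply Rabs_pos.
  assert (HD : 0 <= C / (1 - theta)).
  { apply Rmult_le_pos; [lra|]; apply Rlt_le, Rinv_0_lt_compat; lra. }
  exists (C / (1 - theta)); split; [exact HD|].
  assert (H1 : forall m x, 0 <= x <= 1 -> Rabs (iterate Op m x) <= C / (1 - theta)).
  { induction m as [|m IH]; intros x Hx.
    - simpl; rewrite Rabs_R0; exact HD.
    - replace (iterate Op (S m) x)
        with ((Op (iterate Op m) x - Op (fun _ => 0) x) + iterate Op 1 x)
        by (simpl; unfold iterate; ring).
      apply Rle_trans with (1 := Rabs_triang _ _).
      replace (C / (1 - theta)) with (theta * (C / (1 - theta)) + C) by (field; lra).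
      apply Rplus_le_compat; [|now apply Hx0].
      apply Op_contraction.
      + apply iterate_continuous.
      + intros; apply continuous_const.
      + intros y Hy; rewrite Rminus_0_r; auto. }
  induction k as [|k IH]; intros m x Hx.
  - simpl; rewrite Rminus_0_r, Rmult_1_r; now apply H1.
  - simpl; replace (C / (1 - theta) * (theta * theta ^ k))
      with (theta * (C / (1 - theta) * theta ^ k)) by ring.
    apply Op_contraction; [apply iterate_continuous ..|].
    intros; now apply IH.
Qed.

Lemma geometric_small (C eps : R) :
  0 <= C -> 0 < eps -> exists k, C * theta ^ k < eps.
Proof.
  intros HC Heps.
  destruct (pow_lt_1_zero theta) with (y := eps / (C + 1)) as [K HK].
  { rewrite Rabs_pos_eq; lra. }
  { apply Rdiv_lt_0_compat; lra. }
  specialize (HK K (Nat.le_refl K)).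
  rewrite Rabs_pos_eq in HK by (apply pow_le; lra).
  exists K; apply Rle_lt_trans with ((C + 1) * theta ^ K).
  - apply Rmult_le_compat_r; [apply pow_le|]; lra.
  - apply Rmult_lt_compat_l with (r := C + 1) in HK; [|lra].
    now replace ((C + 1) * (eps / (C + 1))) with eps in HK by (field; lra).
Qed.

(** The constant in [iterate_geometric] does not depend on [m], so the iterates are Cauchy and the
    bound survives the limit [m -> oo]. The limit is thus finite, and [real] loses nothing. *)
Lemma fixpoint_approx :
  exists C, 0 <= C /\ forall k x,
    Rabs (fixpoint Op x - iterate Op k (clamp x)) <= C * theta ^ k.
Proof.
  destruct iterate_geometric as [C [HC HI]].
  exists C; split; [exact HC|]; intros k x.
  assert (Hx := clamp_bounds x).
  assert (Hex : ex_finite_lim_seq (fun k => iterate Op k (clamp x))).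
  { apply ex_lim_seq_cauchy_corr; intros eps.
    destruct (geometric_small C (eps / 2)) as [K HK']; [exact HC|generalize (cond_pos eps); lra|].
    exists K; intros i j Hi Hj.
    assert (A1 := HI K (i - K)%nat (clamp x) Hx); assert (A2 := HI K (j - K)%nat (clamp x) Hx).
    replace (K + (i - K))%nat with i in A1 by lia.
    replace (K + (j - K))%nat with j in A2 by lia.
    apply Rabs_le_between in A1; apply Rabs_le_between in A2.
    apply Rabs_def1; lra. }
  apply Lim_seq_correct' in Hex.
  assert (Hlim : is_lim_seq (fun m => Rabs (iterate Op (k + m) (clamp x) - iterate Op k (clamp x)))
            (Rabs (fixpoint Op x - iterate Op k (clamp x)))).
  { apply (is_lim_seq_abs _ (Finite (fixpoint Op x - iterate Op k (clamp x)))).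
    apply is_lim_seq_minus'; [|apply is_lim_seq_const].
    apply is_lim_seq_ext with (fun m => iterate Op (m + k) (clamp x)).
    { intros m; now rewrite Nat.add_comm. }
    apply (is_lim_seq_incr_n (fun m => iterate Op m (clamp x))); exact Hex. }
  exact (is_lim_seq_le _ _ _ (Finite (C * theta ^ k)) (fun m => HI k m (clamp x) Hx)
           Hlim (is_lim_seq_const _)).
Qed.

(** A uniform limit of continuous functions: two errors of [eps/4] and an oscillation of [eps/2] for
    a single iterate. *)
Lemma fixpoint_continuous (x : R) : continuous (fixpoint Op) x.
Proof.
  destruct fixpoint_approx as [C [HC HP]].
  apply filterlim_locally; intros eps.
  destruct (geometric_small C (eps / 4)) as [k Hk]; [exact HC|generalize (cond_pos eps); lra|].
  assert (Hc : continuous (fun y => iterate Op k (clamp y)) x)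
    by (apply continuous_clamp_comp; intros; apply iterate_continuous).
  apply filterlim_locally with (eps := pos_div_2 eps) in Hc.
  apply filter_imp with (2 := Hc); intros y Hy.
  change (Rabs (iterate Op k (clamp y) - iterate Op k (clamp x)) < eps / 2) in Hy.
  change (Rabs (fixpoint Op y - fixpoint Op x) < eps).
  assert (A1 := HP k x); assert (A2 := HP k y).
  apply Rabs_le_between in A1; apply Rabs_le_between in A2; apply Rabs_def2 in Hy.
  apply Rabs_def1; lra.
Qed.

(** [Op] sends iterate [k] to iterate [S k], so [Op (fixpoint Op)] and [fixpoint Op] both lie within
    [C * theta ^ k] of iterate [S k], for every [k]. *)
Lemma fixpoint_eq (x : R) : 0 <= x <= 1 -> Op (fixpoint Op) x = fixpoint Op x.
Proof.
  intros Hx.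
  destruct fixpoint_approx as [C [HC HP]].
  apply cond_eq; intros eps Heps.
  destruct (geometric_small C (eps / 4)) as [k Hk]; [exact HC|lra|].
  assert (A1 := HP (S k) x); rewrite clamp_id in A1 by exact Hx.
  assert (A2 : Rabs (Op (fixpoint Op) x - Op (iterate Op k) x) <= theta * (C * theta ^ k)).
  { apply Op_contraction.
    - apply fixpoint_continuous.
    - apply iterate_continuous.
    - intros y Hy; assert (A := HP k y); rewrite clamp_id in A by exact Hy; exact A. }
  simpl in A1.
  replace (C * (theta * theta ^ k)) with (theta * (C * theta ^ k)) in A1 by ring.
  assert (theta * (C * theta ^ k) <= 1 * (C * theta ^ k)).
  { apply Rmult_le_compat_r; [apply Rmult_le_pos; [|apply pow_le]|]; lra. }
  apply Rabs_le_between in A1; apply Rabs_le_between in A2.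
  apply Rabs_def1; lra.
Qed.

End Contraction.

(** * The integral operator for the inverse function, and its fixed point *)

Definition admissible (h : R -> R) : Prop :=
  (forall s, continuous h s) /\ (forall s, 0 <= h s) /\
  (forall s, 0 < s <= 1 -> 0 < h s).

(** An integral over [0,x] is scaled to [0,1], which divides out [x ^ (n + 2)]: the value at [x = 0]
    becomes positive, and the singularity at the top of the profile disappears. *)
Definition moment (n : nat) (h p : R -> R) (x : R) : R :=
  2 * (INR n + 2) *
  RInt (fun t => (exp (INR n * p (x * t)) * h (1 - (x * t) ^ 2)) * t ^ S n) 0 1.

(** The (n+2)-th root, written with [exp] and [ln] so as to be positive for every [x], even where
    the moment has no known sign. *)
Definition moment_root (n : nat) (h p : R -> R) (x : R) : R :=
  exp (ln (moment n h p x) / (INR n + 2)).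

(** The inner [clamp] lets bounds proved on [0,1] hold for all real [x]; the outer one keeps the
    argument in [0,1], where the moment is positive, so that the integrand is continuous in [t] on
    the whole line. *)
Definition shootOp (n : nat) (h p : R -> R) (x : R) : R :=
  ln (2 * RInt (fun t => / moment_root n h p (clamp (clamp x * t))) 0 1).

Definition profile (n : nat) (h : R -> R) : R -> R := fixpoint (shootOp n h).

Lemma RInt_Rscal (f : R -> R) (a b c : R) :
  ex_RInt f a b -> RInt (fun x => c * f x) a b = c * RInt f a b.
Proof. exact (RInt_scal (V := R_CompleteNormedModule) f a b c). Qed.

Section Operator.

Variable n : nat.
Let m2 : 0 < INR n + 2.
Proof. generalize (pos_INR n); lra. Qed.

Section OneWeight.

Variable h : R -> R.
Hypothesis h_adm : admissible h.

Lemma moment_integrand_continuous (p : R -> R) (x : R) :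
  (forall y, continuous p y) ->
  continuous (fun y => exp (INR n * p y) * h (1 - y ^ 2)) x.
Proof.
  destruct h_adm as [hc _]; intros Hp.
  assert (Hpx := Hp x).
  cont.
  apply (continuous_comp (fun y => 1 - y ^ 2) h); auto.
  cont.
Qed.

Lemma moment_integrand_t_continuous (p : R -> R) (x t : R) :
  (forall y, continuous p y) ->
  continuous (fun t => (exp (INR n * p (x * t)) * h (1 - (x * t) ^ 2)) * t ^ S n) t.
Proof.
  intros Hp; apply Rcontinuous_mult; [|cont].
  apply (continuous_comp (fun t => x * t) (fun y => exp (INR n * p y) * h (1 - y ^ 2))).
  - cont.
  - now apply moment_integrand_continuous.
Qed.

Lemma moment_continuous (p : R -> R) (x : R) :
  (forall y, continuous p y) -> continuous (moment n h p) x.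
Proof.
  intros Hp; unfold moment; apply Rcontinuous_mult; [apply continuous_const|].
  apply (continuous_RInt_dilation (fun y => exp (INR n * p y) * h (1 - y ^ 2))
           (fun t => t ^ S n)).
  - intros; now apply moment_integrand_continuous.
  - intros; cont.
Qed.

Lemma moment_pos (p : R -> R) (x : R) :
  (forall y, continuous p y) -> 0 <= x <= 1 -> 0 < moment n h p x.
Proof.
  intros Hp Hx; apply Rmult_lt_0_compat; [lra|].
  apply RInt_gt_0; [lra| |].
  - intros t Ht; apply Rmult_lt_0_compat; [|apply pow_lt; lra].
    apply Rmult_lt_0_compat; [apply exp_pos|].
    assert (0 <= x * t < 1) by nra.
    apply h_adm; nra.
  - intros; now apply moment_integrand_t_continuous.
Qed.

Lemma moment_root_pos (p : R -> R) (x : R) : 0 < moment_root n h p x.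
Proof. apply exp_pos. Qed.

Lemma moment_root_continuous (p : R -> R) (x : R) :
  (forall y, continuous p y) -> 0 <= x <= 1 -> continuous (moment_root n h p) x.
Proof.
  intros Hp Hx; unfold moment_root; apply Rcontinuous_exp.
  apply Rcontinuous_mult; [|apply continuous_const].
  apply Rcontinuous_ln; [now apply moment_pos|now apply moment_continuous].
Qed.

Lemma inv_root_continuous (p : R -> R) (x : R) :
  (forall y, continuous p y) -> continuous (fun x => / moment_root n h p (clamp x)) x.
Proof.
  intros Hp; apply (continuous_clamp_comp (fun x => / moment_root n h p x)); intros y Hy.
  apply Rcontinuous_inv; [apply Rgt_not_eq, moment_root_pos|now apply moment_root_continuous].
Qed.

Lemma inv_root_t_continuous (p : R -> R) (x t : R) :
  (forall y, continuous p y) ->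
  continuous (fun t => / moment_root n h p (clamp (x * t))) t.
Proof.
  intros Hp.
  apply (continuous_comp (fun t => x * t) (fun y => / moment_root n h p (clamp y))).
  - cont.
  - now apply inv_root_continuous.
Qed.

Lemma inv_root_RInt_pos (p : R -> R) (x : R) :
  (forall y, continuous p y) ->
  0 < RInt (fun t => / moment_root n h p (clamp (clamp x * t))) 0 1.
Proof.
  intros Hp; apply RInt_gt_0; [lra| |].
  - intros; apply Rinv_0_lt_compat, moment_root_pos.
  - intros; now apply inv_root_t_continuous.
Qed.

Lemma shootOp_continuous (p : R -> R) :
  (forall y, continuous p y) -> forall x, continuous (shootOp n h p) x.
Proof.
  intros Hp x; unfold shootOp; apply Rcontinuous_ln.
  - apply Rmult_lt_0_compat; [lra|]; now apply inv_root_RInt_pos.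
  - apply Rcontinuous_mult; [apply continuous_const|].
    apply (continuous_comp clamp
             (fun x => RInt (fun t => / moment_root n h p (clamp (x * t))) 0 1)).
    { apply continuous_clamp. }
    apply continuous_ext with
      (fun x => RInt (fun t => / moment_root n h p (clamp (x * t)) * 1) 0 1).
    { intros y; apply RInt_ext; intros; apply Rmult_1_r. }
    apply (continuous_RInt_dilation (fun y => / moment_root n h p (clamp y)) (fun _ => 1)).
    + intros; now apply inv_root_continuous.
    + intros; apply continuous_const.
Qed.

(** The unknown enters only through [exp (INR n * p)], so raising it by [d] multiplies the
    nonnegative integrand by [exp (INR n * d)]. *)
Lemma moment_le_shift (p q : R -> R) (d x : R) :
  (forall y, continuous p y) -> (forall y, continuous q y) ->
  (forall y, 0 <= y <= 1 -> p y <= q y + d) -> 0 <= x <= 1 ->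
  moment n h p x <= exp (INR n * d) * moment n h q x.
Proof.
  intros Hp Hq Hpq Hx; unfold moment.
  rewrite <- (Rmult_assoc (exp _)), (Rmult_comm (exp _)), (Rmult_assoc _ (exp _)).
  apply Rmult_le_compat_l; [lra|].
  rewrite <- RInt_Rscal
    by (apply ex_RInt_of_continuous; intros; now apply moment_integrand_t_continuous).
  apply RInt_le; [lra| | |].
  - apply ex_RInt_of_continuous; intros; now apply moment_integrand_t_continuous.
  - apply ex_RInt_of_continuous; intros; apply Rcontinuous_mult;
      [apply continuous_const|now apply moment_integrand_t_continuous].
  - intros t Ht; rewrite <- 2!Rmult_assoc.
    apply Rmult_le_compat_r; [apply pow_le; lra|].
    apply Rmult_le_compat_r; [apply h_adm|].
    rewrite <- exp_plus.
    assert (E : INR n * p (x * t) <= INR n * d + INR n * q (x * t)).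
    { rewrite <- Rmult_plus_distr_l; apply Rmult_le_compat_l; [apply pos_INR|].
      rewrite Rplus_comm; apply Hpq; nra. }
    destruct E as [E| ->]; [apply Rlt_le, exp_increasing, E|apply Rle_refl].
Qed.

End OneWeight.

(* [shootOp] is antitone, and the exponent [1/(n+2)] damps perturbations of the moment. *)
Lemma shootOp_le_of_moment (h1 h2 p q : R -> R) (c x : R) :
  admissible h1 -> admissible h2 ->
  (forall y, continuous p y) -> (forall y, continuous q y) ->
  (forall y, 0 <= y <= 1 -> moment n h1 p y <= exp c * moment n h2 q y) ->
  shootOp n h2 q x <= shootOp n h1 p x + c / (INR n + 2).
Proof.
  intros Hh1 Hh2 Hp Hq Hm; unfold shootOp.
  rewrite <- (ln_exp (c / (INR n + 2))).
  rewrite <- ln_mult; [|apply Rmult_lt_0_compat; [lra|now apply inv_root_RInt_pos]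
                      |apply exp_pos].
  apply ln_le; [apply Rmult_lt_0_compat; [lra|now apply inv_root_RInt_pos]|].
  rewrite Rmult_assoc; apply Rmult_le_compat_l; [lra|].
  rewrite (Rmult_comm _ (exp _)), <- RInt_Rscal
    by (apply ex_RInt_of_continuous; intros; now apply inv_root_t_continuous).
  apply RInt_le; [lra| | |].
  - apply ex_RInt_of_continuous; intros; now apply inv_root_t_continuous.
  - apply ex_RInt_of_continuous; intros; apply Rcontinuous_mult;
      [apply continuous_const|now apply inv_root_t_continuous].
  - intros t Ht.
    assert (Hy := clamp_bounds (clamp x * t)); set (y := clamp (clamp x * t)) in *.
    unfold moment_root; rewrite <- 2!exp_Ropp, <- exp_plus.
    assert (E : ln (moment n h1 p y) <= c + ln (moment n h2 q y)).
    { rewrite <- (ln_exp c) at 1; rewrite <- ln_mult; [|apply exp_pos|now apply moment_pos].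
      apply ln_le; [now apply moment_pos|now apply Hm]. }
    assert (E2 : - (ln (moment n h2 q y) / (INR n + 2)) <=
                 c / (INR n + 2) + - (ln (moment n h1 p y) / (INR n + 2))).
    { apply Rmult_le_reg_r with (INR n + 2); [exact m2|].
      replace ((c / (INR n + 2) + - (ln (moment n h1 p y) / (INR n + 2))) * (INR n + 2))
        with (c - ln (moment n h1 p y)) by (field; lra).
      replace (- (ln (moment n h2 q y) / (INR n + 2)) * (INR n + 2))
        with (- ln (moment n h2 q y)) by (field; lra).
      lra. }
    destruct E2 as [E2| ->]; [apply Rlt_le, exp_increasing, E2|apply Rle_refl].
Qed.

(** A distance [d] costs a factor [exp (INR n * d)] in the moment, which the (n+2)-th root turns
    into a shift of the logarithm by [INR n * d / (INR n + 2)]. The argument is run in both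
    orders. *)
Lemma shootOp_contraction (h p q : R -> R) (d : R) :
  admissible h ->
  (forall y, continuous p y) -> (forall y, continuous q y) ->
  (forall y, 0 <= y <= 1 -> Rabs (p y - q y) <= d) ->
  forall x, Rabs (shootOp n h p x - shootOp n h q x) <= INR n / (INR n + 2) * d.
Proof.
  intros Hh Hp Hq Hd x.
  assert (H1 : shootOp n h q x <= shootOp n h p x + INR n * d / (INR n + 2)).
  { apply shootOp_le_of_moment; auto; intros y Hy; apply moment_le_shift; auto.
    intros z Hz; generalize (Hd z Hz); intros A; apply Rabs_le_between in A; lra. }
  assert (H2 : shootOp n h p x <= shootOp n h q x + INR n * d / (INR n + 2)).
  { apply shootOp_le_of_moment; auto; intros y Hy; apply moment_le_shift; auto.
    intros z Hz; generalize (Hd z Hz); intros A; apply Rabs_le_between in A; lra. }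
  replace (INR n / (INR n + 2) * d) with (INR n * d / (INR n + 2)) by (field; lra).
  apply Rabs_le; lra.
Qed.

Let theta_bounds : 0 <= INR n / (INR n + 2) < 1.
Proof.
  assert (Hn := pos_INR n); split.
  - apply Rmult_le_pos; [exact Hn|]; apply Rlt_le, Rinv_0_lt_compat, m2.
  - apply Rmult_lt_reg_r with (INR n + 2); [exact m2|].
    replace (INR n / (INR n + 2) * (INR n + 2)) with (INR n) by (field; lra); lra.
Qed.

Lemma profile_continuous (h : R -> R) (x : R) :
  admissible h -> continuous (profile n h) x.
Proof.
  intros Hh; apply fixpoint_continuous with (INR n / (INR n + 2)).
  - exact theta_bounds.
  - intros; now apply shootOp_continuous.
  - intros; now apply shootOp_contraction.
Qed.

Lemma profile_eq (h : R -> R) (x : R) :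
  admissible h -> 0 <= x <= 1 -> shootOp n h (profile n h) x = profile n h x.
Proof.
  intros Hh; apply fixpoint_eq with (INR n / (INR n + 2)).
  - exact theta_bounds.
  - intros; now apply shootOp_continuous.
  - intros; now apply shootOp_contraction.
Qed.

(** Let [d] be the maximal distance of the two profiles. Passing from one weight to the other costs
    [eta], and from one profile to the other [INR n * d], so the two fixed-point equations give
    [d <= (INR n * d + eta) / (INR n + 2)], that is, [2 * d <= eta]. The weights are compared along
    the profile of [h1] alone, so no bound on that of [h2] is required beforehand. *)
Lemma profile_stable_of_moment (h1 h2 : R -> R) (eta : R) :
  admissible h1 -> admissible h2 ->
  (forall x, 0 <= x <= 1 ->
     moment n h1 (profile n h1) x <= exp eta * moment n h2 (profile n h1) x /\
     moment n h2 (profile n h1) x <= exp eta * moment n h1 (profile n h1) x) ->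
  forall x, 0 <= x <= 1 -> Rabs (profile n h1 x - profile n h2 x) <= eta / 2.
Proof.
  intros Hh1 Hh2 Hm.
  assert (C1 : forall x, continuous (profile n h1) x)
    by (intros; now apply profile_continuous).
  assert (C2 : forall x, continuous (profile n h2) x)
    by (intros; now apply profile_continuous).
  destruct (continuous_maximum (fun x => Rabs (profile n h1 x - profile n h2 x)))
    as [x0 [Hx0 Hmax]].
  { intros x; apply (continuous_Rabs_comp (fun x => profile n h1 x - profile n h2 x)).
    apply (Rcontinuous_minus (profile n h1) (profile n h2)); [apply C1|apply C2]. }
  set (d := Rabs (profile n h1 x0 - profile n h2 x0)) in *.
  assert (H1 : shootOp n h2 (profile n h2) x0 <=
               shootOp n h1 (profile n h1) x0 + (eta + INR n * d) / (INR n + 2)).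
  { apply shootOp_le_of_moment; auto; intros y Hy.
    apply Rle_trans with (1 := proj1 (Hm y Hy)).
    rewrite exp_plus, Rmult_assoc; apply Rmult_le_compat_l; [apply Rlt_le, exp_pos|].
    apply moment_le_shift; auto.
    intros z Hz; generalize (Hmax z Hz); intros A; apply Rabs_le_between in A; lra. }
  assert (H2 : shootOp n h1 (profile n h1) x0 <=
               shootOp n h2 (profile n h2) x0 + (INR n * d + eta) / (INR n + 2)).
  { apply shootOp_le_of_moment; auto; intros y Hy.
    apply Rle_trans with (exp (INR n * d) * moment n h2 (profile n h1) y).
    - apply moment_le_shift; auto.
      intros z Hz; generalize (Hmax z Hz); intros A; apply Rabs_le_between in A; lra.
    - rewrite exp_plus, Rmult_assoc; apply Rmult_le_compat_l; [apply Rlt_le, exp_pos|].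
      apply (Hm y Hy). }
  rewrite !profile_eq in H1, H2 by auto.
  assert (Hd : d <= (INR n * d + eta) / (INR n + 2)).
  { rewrite (Rplus_comm eta) in H1; unfold d at 1; apply Rabs_le; lra. }
  apply Rmult_le_compat_r with (r := INR n + 2) in Hd; [|lra].
  replace ((INR n * d + eta) / (INR n + 2) * (INR n + 2)) with (INR n * d + eta) in Hd
    by (field; lra).
  intros x Hx; apply Rle_trans with (1 := Hmax x Hx); lra.
Qed.

(** Along its own profile the moment of [h1] has a positive minimum on [0,1], so a small absolute
    change of weight is a small relative change of moment. *)
Lemma profile_stable (h1 : R -> R) (eps : R) :
  admissible h1 -> 0 < eps ->
  exists delta, 0 < delta /\ forall h2, admissible h2 ->
    (forall s, 0 <= s <= 1 -> Rabs (h2 s - h1 s) <= delta) ->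
    Rabs (profile n h2 1 - profile n h1 1) < eps.
Proof.
  intros Hh1 Heps.
  assert (C1 : forall x, continuous (profile n h1) x)
    by (intros; now apply profile_continuous).
  set (p := profile n h1) in *.
  destruct (continuous_maximum (fun x => exp (INR n * p x))) as [xB [_ HB]].
  { intros x; assert (Cx := C1 x); cont. }
  set (B := exp (INR n * p xB)) in *.
  assert (B0 : 0 < B) by apply exp_pos.
  destruct (continuous_maximum (fun x => - moment n h1 p x)) as [xm [Hxm Hm]].
  { intros x; apply Rcontinuous_opp, moment_continuous; auto. }
  set (m := moment n h1 p xm) in *.
  assert (m0 : 0 < m) by (apply moment_pos; auto).
  set (C := 2 * (INR n + 2) * B).
  assert (C0 : 0 < C) by (unfold C; apply Rmult_lt_0_compat; lra).
  (* The bound [eta <= 1] gives [(1 + eta) * (1 - eta / 2) >= 1], which turns an error [m * eta / 2]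
     in the moment into a factor [1 + eta <= exp eta]. *)
  set (eta := Rmin eps 1).
  assert (eta0 : 0 < eta <= 1 /\ eta <= eps) by (unfold eta, Rmin; destruct (Rle_dec _ _); lra).
  (* A change of weight by [delta] alters the moment by at most [C * delta], here [m * eta / 2]. *)
  exists (m * eta / (2 * C)); split.
  { apply Rdiv_lt_0_compat; [apply Rmult_lt_0_compat|]; lra. }
  intros h2 Hh2 Hd.
  assert (HM : forall x, 0 <= x <= 1 ->
            Rabs (moment n h2 p x - moment n h1 p x) <= m * eta / 2).
  { intros x Hx; unfold moment.
    rewrite <- Rmult_minus_distr_l, Rabs_mult, (Rabs_pos_eq (2 * _)) by lra.
    rewrite <- (RInt_minus (V := R_CompleteNormedModule));
      try (apply ex_RInt_of_continuous; intros; now apply moment_integrand_t_continuous).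
    replace (m * eta / 2)
      with (2 * (INR n + 2) * ((1 - 0) * (B * (m * eta / (2 * C)))))
      by (unfold C; field; lra).
    apply Rmult_le_compat_l; [lra|].
    apply abs_RInt_le_const; [lra| |].
    - apply (ex_RInt_minus (V := R_NormedModule)); apply ex_RInt_of_continuous;
        intros; now apply moment_integrand_t_continuous.
    - intros t Ht.
      change (Rabs (exp (INR n * p (x * t)) * h2 (1 - (x * t) ^ 2) * t ^ S n -
                    exp (INR n * p (x * t)) * h1 (1 - (x * t) ^ 2) * t ^ S n)
              <= B * (m * eta / (2 * C))).
      replace (exp (INR n * p (x * t)) * h2 (1 - (x * t) ^ 2) * t ^ S n -
               exp (INR n * p (x * t)) * h1 (1 - (x * t) ^ 2) * t ^ S n)
        with (exp (INR n * p (x * t)) * ((h2 (1 - (x * t) ^ 2) - h1 (1 - (x * t) ^ 2)) * t ^ S n))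
        by ring.
      assert (Hxt : 0 <= x * t <= 1) by nra.
      rewrite Rabs_mult, (Rabs_pos_eq (exp _)) by (apply Rlt_le, exp_pos).
      apply Rmult_le_compat; [apply Rlt_le, exp_pos|apply Rabs_pos|now apply HB|].
      rewrite Rabs_mult, <- (Rmult_1_r (m * eta / (2 * C))).
      apply Rmult_le_compat; [apply Rabs_pos|apply Rabs_pos|apply Hd; nra|].
      rewrite Rabs_pos_eq by (apply pow_le; lra).
      rewrite <- (pow1 (S n)); apply pow_incr; lra. }
  apply Rle_lt_trans with (eta / 2); [|lra].
  rewrite Rabs_minus_sym.
  apply profile_stable_of_moment; auto; [|lra].
  intros x Hx; change (profile n h1) with p.
  assert (A := HM x Hx); apply Rabs_le_between in A.
  assert (A2 : m <= moment n h1 p x) by (generalize (Hm x Hx); lra).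
  assert (E := exp_ineq1_le eta).
  assert (P2 : 0 < moment n h2 p x) by (apply moment_pos; auto).
  split.
  - apply Rle_trans with ((1 + eta) * moment n h2 p x); [nra|].
    apply Rmult_le_compat_r; lra.
  - apply Rle_trans with ((1 + eta) * moment n h1 p x); [nra|].
    apply Rmult_le_compat_r; lra.
Qed.

End Operator.

(** * Derivatives, primitives and inverse functions *)

Ltac real_eq := match goal with |- @eq _ ?a ?b => change (@eq R a b) end.

Lemma is_derive_continuous (f : R -> R) (x l : R) : is_derive f x l -> continuous f x.
Proof.
  intros H; apply (@ex_derive_continuous R_AbsRing R_NormedModule); now exists l.
Qed.

Lemma is_derive_root (g : R -> R) (x dg c : R) :
  0 < g x -> is_derive g x dg ->
  is_derive (fun y => exp (ln (g y) / c)) x (exp (ln (g x) / c) * (dg / g x / c)).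
Proof.
  intros Hg Dg; auto_derive; [split; [now exists dg|split; [exact Hg|trivial]]|].
  replace (Derive (fun y => g y) x) with dg by (symmetry; now apply is_derive_unique).
  unfold Rdiv; ring.
Qed.

Lemma mean_value (f df : R -> R) (a b : R) :
  (forall x, Rmin a b <= x <= Rmax a b -> is_derive f x (df x)) ->
  exists c, Rmin a b <= c <= Rmax a b /\ f b - f a = df c * (b - a).
Proof.
  intros H; apply MVT_gen.
  - intros x Hx; apply H; lra.
  - intros x Hx; apply continuity_pt_filterlim, (is_derive_continuous f x (df x)), H, Hx.
Qed.

Lemma is_derive_primitive (f : R -> R) (x : R) :
  (forall y, continuous f y) -> is_derive (fun x => RInt f 0 x) x (f x).
Proof.
  intros Hf; apply is_derive_RInt with 0; [|apply Hf].
  apply filter_forall; intros y; apply (RInt_correct (V := R_CompleteNormedModule)).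
  now apply ex_RInt_of_continuous.
Qed.

Lemma RInt_dilation (F : R -> R) (x : R) :
  (forall y, continuous F y) -> RInt (fun t => x * F (x * t)) 0 1 = RInt F 0 x.
Proof.
  intros HF.
  assert (E := RInt_comp_lin (V := R_CompleteNormedModule) F x 0 0 1).
  replace (x * 0 + 0) with 0 in E by ring.
  replace (x * 1 + 0) with x in E by ring.
  rewrite <- E by now apply ex_RInt_of_continuous.
  apply RInt_ext; intros t _; rewrite Rplus_0_r; reflexivity.
Qed.

(** A slope of at least [c] makes [r] onto and its inverse Lipschitz with constant [1 / c]; the
    derivative of the inverse then comes from the mean value theorem and the continuity of [dr]. *)
Lemma smooth_inverse (r dr : R -> R) (c : R) :
  0 < c -> (forall x, c <= dr x) ->
  (forall x, is_derive r x (dr x)) -> (forall x, continuous dr x) ->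
  exists X, (forall rho, r (X rho) = rho) /\ (forall x, X (r x) = x) /\
            (forall rho, is_derive X rho (/ dr (X rho))).
Proof.
  intros Hc Hlow Hr Hdr.
  assert (Cr : continuity r).
  { intros x; apply continuity_pt_filterlim, (is_derive_continuous r x (dr x)), Hr. }
  assert (MV : forall a b, exists xi, Rmin a b <= xi <= Rmax a b /\
                 r b - r a = dr xi * (b - a)).
  { intros a b; apply mean_value; auto. }
  assert (Sol : forall rho, {x | r x = rho}).
  (* At distance [A] from 0 the function has moved by at least [c * A = Rabs (rho - r 0)], so
     [-A, A] contains a preimage of [rho]. *)
  { intros rho; set (A := Rabs (rho - r 0) / c).
    assert (HA : 0 <= A).
    { apply Rmult_le_pos; [apply Rabs_pos|]; apply Rlt_le, Rinv_0_lt_compat, Hc. }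
    assert (HcA : c * A = Rabs (rho - r 0)) by (unfold A; field; lra).
    assert (Hup : rho <= r A).
    { destruct (MV 0 A) as [xi [_ E]]; generalize (Hlow xi) (Rle_abs (rho - r 0)); nra. }
    assert (Hdn : r (- A) <= rho).
    { destruct (MV (- A) 0) as [xi [_ E]].
      generalize (Hlow xi) (Rle_abs (- (rho - r 0))); rewrite Rabs_Ropp; nra. }
    destruct (IVT_gen r (- A) A rho Cr) as [x [_ Hx]].
    { rewrite Rmin_left, Rmax_right; lra. }
    now exists x. }
  set (X := fun rho => proj1_sig (Sol rho)).
  assert (HX : forall rho, r (X rho) = rho) by (intros rho; apply (proj2_sig (Sol rho))).
  assert (Dist : forall a b, c * Rabs (b - a) <= Rabs (r b - r a)).
  { intros a b; destruct (MV a b) as [xi [_ ->]].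
    rewrite Rabs_mult; apply Rmult_le_compat_r; [apply Rabs_pos|].
    apply Rle_trans with (1 := Hlow xi), Rle_abs. }
  exists X; split; [exact HX|split].
  - intros x; apply cond_eq; intros eps Heps.
    assert (D := Dist x (X (r x))); rewrite HX, Rminus_diag, Rabs_R0 in D.
    generalize (Rabs_pos (X (r x) - x)); nra.
  - intros rho; apply is_derive_Reals; intros eps Heps.
    assert (Ci : continuous (fun x => / dr x) (X rho)).
    { apply Rcontinuous_inv; auto; generalize (Hlow (X rho)); lra. }
    apply filterlim_locally with (eps := mkposreal eps Heps) in Ci.
    destruct Ci as [d Hd].
    assert (Hcd : 0 < c * d) by (apply Rmult_lt_0_compat; [exact Hc|apply cond_pos]).
    exists (mkposreal _ Hcd); simpl; intros k Hk0 Hk.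
    destruct (MV (X rho) (X (rho + k))) as [xi [Hxi E]].
    assert (D := Dist (X rho) (X (rho + k))).
    rewrite !HX in E, D; replace (rho + k - rho) with k in E, D by ring.
    assert (Hlt : Rabs (X (rho + k) - X rho) < d) by nra.
    assert (Hx : Rabs (xi - X rho) < d).
    { apply Rle_lt_trans with (2 := Hlt).
      apply Rabs_le_between_min_max.
      now rewrite Rmin_comm, Rmax_comm. }
    (* The mean value theorem gives [k = dr xi * (X (rho + k) - X rho)], so the difference quotient
       is exactly [/ dr xi], and [xi] is within [d] of [X rho]. *)
    replace ((X (rho + k) - X rho) / k) with (/ dr xi).
    + exact (Hd xi Hx).
    + generalize dependent (X (rho + k) - X rho); intros D E _ _.
      rewrite E; generalize (Hlow xi); intros; field; split; [|lra].
      intros E0; rewrite E0, Rmult_0_r in E; auto.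
Qed.

(** * From the fixed point to a radial solution *)

Definition radial_solution (n : nat) (h : R -> R) (rad : R) (W W1 W2 : R -> R) : Prop :=
  (forall rho, 0 <= rho <= rad ->
     is_derive W rho (W1 rho) /\ is_derive W1 rho (W2 rho) /\ continuous W2 rho /\
     is_derive (fun s => (- W1 s) ^ S n) rho (INR (S n) * rho ^ n * h (W rho)) /\
     0 <= W rho <= 1) /\
  (forall rho, 0 < rho < rad -> 0 < W rho /\ W2 rho < 0) /\
  W 0 = 1 /\ W1 0 = 0 /\ W rad = 0.

Section Profile.

Variables (n : nat) (h : R -> R).
Hypothesis h_adm : admissible h.

Let P := profile n h.
Let M := moment n h P.
Let Z := moment_root n h P.

Let m2 : 0 < INR n + 2.
Proof. generalize (pos_INR n); lra. Qed.

Let P_continuous (x : R) : continuous P x.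
Proof. now apply profile_continuous. Qed.

Let Z_pos (x : R) : 0 < Z x.
Proof. apply exp_pos. Qed.

Let M_pos (x : R) : 0 <= x <= 1 -> 0 < M x.
Proof. now apply moment_pos. Qed.

Let Z_pow (x : R) : 0 <= x <= 1 -> Z x ^ (n + 2) = M x.
Proof.
  intros Hx; rewrite <- Rpower_pow by apply Z_pos.
  unfold Rpower, Z, moment_root; rewrite ln_exp, plus_INR.
  fold M; replace (INR n + INR 2) with (INR n + 2) by (simpl; ring).
  replace ((INR n + 2) * (ln (M x) / (INR n + 2))) with (ln (M x)) by (field; lra).
  now apply exp_ln, M_pos.
Qed.

(** Clamping keeps the integrand continuous and bounded below by a positive constant on the whole
    line, as [smooth_inverse] requires. *)
Definition radius (x : R) : R := RInt (fun y => 2 * / Z (clamp y)) 0 x.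

Let dradius_continuous (x : R) : continuous (fun y => 2 * / Z (clamp y)) x.
Proof. apply Rcontinuous_mult; [apply continuous_const|now apply inv_root_continuous]. Qed.

Lemma radius_derive (x : R) : is_derive radius x (2 * / Z (clamp x)).
Proof.
  exact (is_derive_primitive (fun y => 2 * / Z (clamp y)) x dradius_continuous).
Qed.

(** This is the fixed-point equation multiplied by [x], with the integral over [0,1] carried to
    [0,x] by [y = x * t]. *)
Lemma radius_eq (x : R) : 0 <= x <= 1 -> radius x = x * exp (P x).
Proof.
  intros Hx; unfold radius; rewrite <- RInt_dilation by exact dradius_continuous.
  unfold P; rewrite <- (profile_eq n h x h_adm Hx); unfold shootOp; fold P.
  rewrite exp_ln by (apply Rmult_lt_0_compat; [lra|now apply inv_root_RInt_pos]).
  rewrite clamp_id by exact Hx.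
  assert (C : forall t, continuous (fun t => / moment_root n h P (clamp (x * t))) t)
    by (intros; now apply inv_root_t_continuous).
  rewrite <- Rmult_assoc, <- RInt_Rscal by now apply ex_RInt_of_continuous.
  apply RInt_ext; intros t _; unfold Z; real_eq; ring.
Qed.

(** The substitution [y = x * t] absorbs the power of [x] and leaves a primitive, which is
    differentiable although [h] is only continuous. *)
Lemma moment_primitive (x : R) :
  x ^ (n + 2) * M x =
  RInt (fun y => 2 * (INR n + 2) * (exp (INR n * P y) * h (1 - y ^ 2) * y ^ S n)) 0 x.
Proof.
  rewrite <- RInt_dilation.
  2:{ intros y; apply Rcontinuous_mult; [apply continuous_const|].
      apply Rcontinuous_mult; [now apply moment_integrand_continuous|cont]. }
  unfold M, moment; rewrite <- Rmult_assoc, <- RInt_Rscal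
    by (apply ex_RInt_of_continuous; intros; now apply moment_integrand_t_continuous).
  apply RInt_ext; intros t _; real_eq.
  rewrite (Rpow_mult_distr x t (S n)).
  replace (n + 2)%nat with (S (S n)) by lia; simpl; ring.
Qed.

Lemma RInt_pow_S : RInt (fun t => t ^ S n) 0 1 = / (INR n + 2).
Proof.
  apply is_RInt_unique.
  replace (/ (INR n + 2)) with (minus (1 ^ (n + 2) / (INR n + 2)) (0 ^ (n + 2) / (INR n + 2))).
  2:{ rewrite pow1, pow_i by lia; unfold minus, plus, opp; simpl; field; lra. }
  apply (is_RInt_derive (V := R_CompleteNormedModule)
           (fun t => t ^ (n + 2) / (INR n + 2)) (fun t => t ^ S n)).
  - intros t _; auto_derive; [trivial|].
    rewrite plus_INR; replace (Init.Nat.pred (n + 2)) with (S n) by lia.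
    simpl; field; lra.
  - intros t _; cont.
Qed.

Lemma moment_0 : M 0 = 2 * exp (INR n * P 0) * h 1.
Proof.
  unfold M, moment.
  rewrite (RInt_ext _ (fun t => (exp (INR n * P 0) * h 1) * t ^ S n)).
  2:{ intros t _; rewrite Rmult_0_l; replace (1 - 0 ^ 2) with 1 by ring; reflexivity. }
  rewrite RInt_Rscal, RInt_pow_S by (apply ex_RInt_of_continuous; intros; cont).
  field; lra.
Qed.

(** In the variable [x], the function [x * Z x] is the slope [- W']. For [x > 0] it is a root of the
    primitive in [moment_primitive]. At 0 its difference quotient is [Z k], which tends to [Z 0],
    and [moment_0] shows that the formula has this value there. *)
Lemma slope_derive (x : R) : 0 <= x <= 1 ->
  is_derive (fun y => y * Z y) x
    (2 * Z x * (exp (INR n * P x) * h (1 - x ^ 2)) / M x).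
Proof.
  intros Hx; destruct (Req_dec x 0) as [->|Hx0].
  - replace (2 * Z 0 * (exp (INR n * P 0) * h (1 - 0 ^ 2)) / M 0) with (Z 0).
    2:{ assert (A := M_pos 0 Hx); revert A; rewrite moment_0.
        replace (1 - 0 ^ 2) with 1 by ring; intros A; field.
        split; intros E; rewrite E in A; lra. }
    apply is_derive_Reals; intros eps Heps.
    assert (CZ : continuous Z 0) by now apply moment_root_continuous.
    apply filterlim_locally with (eps := mkposreal eps Heps) in CZ.
    destruct CZ as [d Hd]; exists d; intros k Hk Hkd.
    replace (((0 + k) * Z (0 + k) - 0 * Z 0) / k) with (Z k)
      by (rewrite Rplus_0_l; field; exact Hk).
    apply Hd; change (Rabs (k - 0) < d); now rewrite Rminus_0_r.
  - assert (Hxp : 0 < x) by lra.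
    set (K := fun x => RInt (fun y => 2 * (INR n + 2) *
                (exp (INR n * P y) * h (1 - y ^ 2) * y ^ S n)) 0 x).
    assert (DK : is_derive K x (2 * (INR n + 2) *
                (exp (INR n * P x) * h (1 - x ^ 2) * x ^ S n))).
    { apply (is_derive_primitive (fun y => 2 * (INR n + 2) *
                (exp (INR n * P y) * h (1 - y ^ 2) * y ^ S n))).
      intros y; apply Rcontinuous_mult; [apply continuous_const|].
      apply Rcontinuous_mult; [now apply moment_integrand_continuous|cont]. }
    assert (EK : K x = x ^ (n + 2) * M x) by (symmetry; apply moment_primitive).
    assert (HMx := M_pos x Hx).
    assert (Hxn : 0 < x ^ (n + 2)) by now apply pow_lt.
    assert (HKx : 0 < K x) by (rewrite EK; now apply Rmult_lt_0_compat).
    (* for [y > 0], [y * Z y] is the [(n+2)]-th root of [K y] *)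
    apply is_derive_ext_loc with (fun y => exp (ln (K y) / (INR n + 2))).
    { assert (CM : continuous M x) by now apply moment_continuous.
      apply filterlim_locally with (eps := mkposreal _ HMx) in CM.
      assert (Lx : locally x (fun y => 0 < y)) by now apply open_gt.
      generalize (filter_and _ _ CM Lx); apply filter_imp; intros y [Hy Hyp].
      change (Rabs (M y - M x) < M x) in Hy; apply Rabs_def2 in Hy.
      unfold K; rewrite <- moment_primitive.
      rewrite ln_mult, ln_pow, plus_INR by (try apply pow_lt; lra).
      unfold Z, moment_root; fold M.
      replace ((((INR n + INR 2) * ln y + ln (M y)) / (INR n + 2)))
        with (ln y + ln (M y) / (INR n + 2)) by (simpl; field; lra).
      rewrite exp_plus, exp_ln by exact Hyp; reflexivity. }
    evar_last; [exact (is_derive_root K x _ (INR n + 2) HKx DK)|].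
    rewrite EK, ln_mult, ln_pow, plus_INR by (try apply pow_lt; lra).
    replace ((((INR n + INR 2) * ln x + ln (M x)) / (INR n + 2)))
        with (ln x + ln (M x) / (INR n + 2)) by (simpl; field; lra).
    rewrite exp_plus, exp_ln by exact Hxp.
    change (exp (ln (M x) / (INR n + 2))) with (Z x).
    replace (n + 2)%nat with (S (S n)) by lia; simpl.
    field; repeat split; try lra; apply pow_nonzero; lra.
Qed.

(** With [X] the inverse of [radius], take [W = 1 - X ^ 2]. Since [X' = Z(X) / 2], this gives
    [- W' = X * Z(X)]. As [X] lives on the whole line, derivatives at the endpoints are
    two-sided. *)
Lemma profile_radial_solution :
  exists W W1 W2, radial_solution n h (exp (P 1)) W W1 W2.
Proof.
  (* The minimum of the slope over [0,1] bounds it on the whole line because of [clamp]. *)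
  destruct (continuous_maximum (fun x => - (2 * / Z (clamp x)))) as [x0 [_ Hx0]].
  { intros x; apply Rcontinuous_opp, dradius_continuous. }
  set (c := 2 * / Z (clamp x0)) in *.
  assert (Hc : 0 < c) by (apply Rmult_lt_0_compat; [lra|apply Rinv_0_lt_compat, Z_pos]).
  assert (Hlow : forall x, c <= 2 * / Z (clamp x)).
  { intros x; generalize (Hx0 (clamp x) (clamp_bounds x)).
    rewrite (clamp_id (clamp x)) by apply clamp_bounds; lra. }
  destruct (smooth_inverse radius _ c Hc Hlow radius_derive dradius_continuous)
    as [X [rX [Xr DX]]].
  assert (mono : forall a b, a < b -> radius a < radius b).
  { intros a b Hab.
    destruct (mean_value radius (fun x => 2 * / Z (clamp x)) a b) as [xi [_ E]].
    { intros; apply radius_derive. }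
    generalize (Hlow xi); nra. }
  assert (r0 : radius 0 = 0) by (rewrite radius_eq; lra).
  assert (r1 : radius 1 = exp (P 1)) by (rewrite radius_eq; lra).
  assert (X0 : X 0 = 0) by (rewrite <- r0 at 1; apply Xr).
  assert (X1 : X (exp (P 1)) = 1) by (rewrite <- r1; apply Xr).
  assert (bX : forall rho, 0 <= rho <= exp (P 1) -> 0 <= X rho <= 1).
  { intros rho Hrho; split; apply Rnot_lt_le; intros Hlt; apply mono in Hlt;
      rewrite rX in Hlt; lra. }
  assert (bX' : forall rho, 0 < rho < exp (P 1) -> 0 < X rho < 1).
  { intros rho Hrho; assert (B : 0 <= X rho <= 1) by (apply bX; lra).
    assert (X rho <> 0) by (intros E; generalize (rX rho); rewrite E; lra).
    assert (X rho <> 1) by (intros E; generalize (rX rho); rewrite E; lra).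
    lra. }
  assert (DX' : forall rho, 0 <= rho <= exp (P 1) -> is_derive X rho (Z (X rho) / 2)).
  { intros rho Hrho; generalize (DX rho); rewrite clamp_id by now apply bX.
    replace (/ (2 * / Z (X rho))) with (Z (X rho) / 2); [trivial|].
    field; generalize (Z_pos (X rho)); lra. }
  (* The derivative from [slope_derive] times [X' = Z / 2]: this is [- W''] in the variable [x]. *)
  set (D2 := fun x => Z x ^ 2 * (exp (INR n * P x) * h (1 - x ^ 2)) / M x).
  assert (DW1 : forall rho, 0 <= rho <= exp (P 1) ->
            is_derive (fun s => X s * Z (X s)) rho (D2 (X rho))).
  { intros rho Hrho; assert (B := bX rho Hrho).
    evar_last.
    - apply (is_derive_comp (fun y => y * Z y) X).
      + now apply slope_derive.
      + now apply DX'.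
    - change (Z (X rho) / 2 *
        (2 * Z (X rho) * (exp (INR n * P (X rho)) * h (1 - X rho ^ 2)) / M (X rho)) =
        D2 (X rho)).
      unfold D2; field; generalize (M_pos _ B); lra. }
  assert (CX : forall rho, 0 <= rho <= exp (P 1) -> continuous X rho).
  { intros rho Hrho; apply (is_derive_continuous X rho _ (DX' rho Hrho)). }
  assert (Hn1 := pos_INR n).
  exists (fun s => 1 - X s ^ 2), (fun s => - (X s * Z (X s))), (fun s => - D2 (X s)).
  split; [|split; [|split; [|split]]].
  - intros rho Hrho; assert (B := bX rho Hrho); assert (ZB := Z_pos (X rho)).
    split; [|split; [|split; [|split]]].
    + assert (D := DX' rho Hrho); auto_derive; [now exists (Z (X rho) / 2)|].
      replace (Derive (fun s => X s) rho) with (Z (X rho) / 2)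
        by (symmetry; now apply is_derive_unique).
      field.
    + apply (is_derive_opp (fun s => X s * Z (X s))); now apply DW1.
    + apply Rcontinuous_opp, (continuous_comp X D2); [now apply CX|].
      unfold D2; apply Rcontinuous_mult;
        [apply Rcontinuous_mult; [apply Rcontinuous_pow; now apply moment_root_continuous|]
        |apply Rcontinuous_inv; [generalize (M_pos _ B); lra|now apply moment_continuous]].
      now apply moment_integrand_continuous.
    + apply is_derive_ext with (fun s => (X s * Z (X s)) ^ S n).
      { intros s; f_equal; ring. }
      evar_last.
      { apply (is_derive_pow (fun s => X s * Z (X s)) (S n)); now apply DW1. }
      simpl Init.Nat.pred; unfold D2.
      (* By [Z ^ (n + 2) = M] all powers of [Z] cancel in [(X * Z) ^ n * D2], and [X * exp P = rho]
         turns the rest into [rho ^ n * h]. *)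
      assert (E := Z_pow _ B).
      assert (Er : X rho * exp (P (X rho)) = rho) by (rewrite <- radius_eq; auto).
      rewrite <- E; replace (rho ^ n) with ((X rho * exp (P (X rho))) ^ n) by now rewrite Er.
      rewrite !Rpow_mult_distr, pow_add.
      replace (exp (INR n * P (X rho))) with (exp (P (X rho)) ^ n).
      2:{ rewrite <- Rpower_pow by apply exp_pos; unfold Rpower; now rewrite ln_exp. }
      field; split; [lra|apply pow_nonzero; lra].
    + nra.
  - intros rho Hrho; assert (B := bX' rho Hrho); split; [nra|].
    assert (A : 0 < D2 (X rho)); [|lra].
    unfold D2; apply Rdiv_lt_0_compat; [|apply M_pos; lra].
    apply Rmult_lt_0_compat; [apply pow_lt, Z_pos|].
    apply Rmult_lt_0_compat; [apply exp_pos|apply h_adm; nra].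
  - rewrite X0; ring.
  - rewrite X0; ring.
  - rewrite X1; ring.
Qed.

End Profile.

(** * Regularity on [0,1] and strict concavity *)

Lemma deriv_on01_of_is_derive (g g1 : R -> R) :
  (forall x, 0 <= x <= 1 -> is_derive g x (g1 x)) -> deriv_on01 g g1.
Proof.
  intros Hg x Hx eps Heps.
  assert (D := Hg x Hx); apply is_derive_Reals in D.
  destruct (D eps Heps) as [d Hd]; exists d; split; [apply cond_pos|].
  intros y Hy Hyx Hyd; specialize (Hd (y - x)).
  replace (x + (y - x)) with y in Hd by ring; apply Hd; lra.
Qed.

Lemma cont_on01_of_continuous (g : R -> R) :
  (forall x, 0 <= x <= 1 -> continuous g x) -> cont_on01 g.
Proof.
  intros Hg x Hx eps Heps.
  assert (D := Hg x Hx).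
  apply filterlim_locally with (eps := mkposreal eps Heps) in D.
  destruct D as [d Hd]; exists d; split; [apply cond_pos|].
  intros y Hy Hyd; exact (Hd y Hyd).
Qed.

Lemma C2_01_of_is_derive (u u1 u2 : R -> R) :
  (forall x, 0 <= x <= 1 ->
     is_derive u x (u1 x) /\ is_derive u1 x (u2 x) /\ continuous u2 x) ->
  C2_01 u u1 u2.
Proof.
  intros H; split; [|split].
  - apply deriv_on01_of_is_derive; intros x Hx; apply (H x Hx).
  - apply deriv_on01_of_is_derive; intros x Hx; apply (H x Hx).
  - apply cont_on01_of_continuous; intros x Hx; apply (H x Hx).
Qed.

Lemma strict_mean_value (f df : R -> R) (a b : R) :
  a < b -> (forall x, a <= x <= b -> is_derive f x (df x)) ->
  exists c, a < c < b /\ f b - f a = df c * (b - a).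
Proof.
  intros Hab H; destruct (MVT_cor2 f df a b Hab) as [c [E Hc]].
  - intros x Hx; now apply is_derive_Reals, H.
  - now exists c.
Qed.

(** The mean slopes on the two sides of the intermediate point are [u1 c1] and [u1 c2] with
    [c1 < c2]; a third mean value, taken for [u1], makes the second one smaller. *)
Lemma strictly_concave_of_second_derivative (u u1 u2 : R -> R) :
  (forall x, 0 < x < 1 -> is_derive u x (u1 x) /\ is_derive u1 x (u2 x) /\ u2 x < 0) ->
  strictly_concave01 u.
Proof.
  intros H.
  assert (Main : forall x y t, 0 < x -> x < y -> y < 1 -> 0 < t < 1 ->
            t * u x + (1 - t) * u y < u (t * x + (1 - t) * y)).
  { intros x y t Hx Hxy Hy Ht.
    set (p := t * x + (1 - t) * y).
    assert (Ex : p - x = (1 - t) * (y - x)) by (unfold p; ring).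
    assert (Ey : y - p = t * (y - x)) by (unfold p; ring).
    assert (Hp : x < p < y) by nra.
    destruct (strict_mean_value u u1 x p) as [c1 [Hc1 E1]]; [lra| |].
    { intros z Hz; apply H; lra. }
    destruct (strict_mean_value u u1 p y) as [c2 [Hc2 E2]]; [lra| |].
    { intros z Hz; apply H; lra. }
    destruct (strict_mean_value u1 u2 c1 c2) as [c3 [Hc3 E3]]; [lra| |].
    { intros z Hz; apply H; lra. }
    assert (H3 : u2 c3 < 0) by (apply H; lra).
    assert (H4 : u1 c2 - u1 c1 < 0) by nra.
    rewrite Ex in E1; rewrite Ey in E2.
    assert (E : u p - (t * u x + (1 - t) * u y) =
                t * (1 - t) * (y - x) * (u1 c1 - u1 c2)).
    { replace (u p) with (u x + u1 c1 * ((1 - t) * (y - x))) by lra.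
      replace (u y) with (u x + u1 c1 * ((1 - t) * (y - x)) + u1 c2 * (t * (y - x))) by lra.
      ring. }
    assert (0 < t * (1 - t) * (y - x) * (u1 c1 - u1 c2)).
    { repeat apply Rmult_lt_0_compat; lra. }
    lra. }
  intros x y t Hx Hy Hxy Ht.
  destruct (Rtotal_order x y) as [L|[L|L]]; [now apply Main|contradiction|].
  generalize (Main y x (1 - t)); replace (1 - (1 - t)) with t by ring; intros A.
  rewrite (Rplus_comm (t * u x)), (Rplus_comm (t * x)); apply A; lra.
Qed.

Lemma strictly_convex_of_second_derivative (u u1 u2 : R -> R) :
  (forall x, 0 < x < 1 -> is_derive u x (u1 x) /\ is_derive u1 x (u2 x) /\ 0 < u2 x) ->
  strictly_convex01 u.
Proof.
  intros H.
  assert (C : strictly_concave01 (fun x => - u x)).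
  { apply strictly_concave_of_second_derivative
      with (u1 := fun x => - u1 x) (u2 := fun x => - u2 x).
    intros x Hx; destruct (H x Hx) as [H1 [H2 H3]]; split; [|split; [|lra]].
    - now apply (is_derive_opp u).
    - now apply (is_derive_opp u1). }
  intros x y t Hx Hy Hxy Ht; generalize (C x y t Hx Hy Hxy Ht); simpl; lra.
Qed.

(** * Dilation, the eigenvalue, and small weights *)

Lemma is_derive_Rscal (f : R -> R) (x c df : R) :
  is_derive f x df -> is_derive (fun y => c * f y) x (c * df).
Proof. intros H; exact (is_derive_scal f x c df H). Qed.

Lemma is_derive_dilate (f : R -> R) (x c df : R) :
  is_derive f (c * x) df -> is_derive (fun y => f (c * y)) x (c * df).
Proof.
  intros H; apply (is_derive_comp f (fun y => c * y) x df c); [exact H|].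
  auto_derive; [trivial|ring].
Qed.

Lemma power_weight_admissible (n : nat) (mu : R) :
  0 < mu -> admissible (fun s => (mu * Rabs s) ^ S n).
Proof.
  intros Hmu; split; [|split].
  - intros s; apply Rcontinuous_pow, Rcontinuous_mult;
      [apply continuous_const|apply continuous_Rabs].
  - intros s; apply pow_le, Rmult_le_pos; [lra|apply Rabs_pos].
  - intros s Hs; apply pow_lt, Rmult_lt_0_compat; [lra|apply Rabs_pos_lt; lra].
Qed.

(** The radial solution rescaled to radius 1 is a positive eigenfunction. Dilation brings out
    [rad ^ S n] from the power, [rad] from the outer derivative and [rad ^ n] from the factor
    [rho ^ n], altogether [(rad ^ 2) ^ S n], so the eigenvalue is [rad ^ 2 * mu] and uniqueness
    applies. *)
Lemma eigenvalue_profile (n : nat) (mu lam1 : R) :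
  0 < mu -> first_eigenvalue (S n) lam1 ->
  exp (profile n (fun s => (mu * Rabs s) ^ S n) 1) ^ 2 * mu = lam1.
Proof.
  intros Hmu [_ [_ Huniq]].
  set (h := fun s => (mu * Rabs s) ^ S n).
  assert (Hh : admissible h) by now apply power_weight_admissible.
  destruct (profile_radial_solution n h Hh) as [W [W1 [W2 [HW [HW' [H0 [H1 HR]]]]]]].
  assert (R0 : 0 < exp (profile n h 1)) by apply exp_pos.
  set (rad := exp (profile n h 1)) in *.
  apply Huniq; [apply Rmult_lt_0_compat; [apply pow_lt|]; lra|].
  exists (fun r => W (rad * r)), (fun r => rad * W1 (rad * r)),
    (fun r => rad * (rad * W2 (rad * r))).
  assert (B : forall r, 0 <= r <= 1 -> 0 <= rad * r <= rad) by (intros; nra).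
  split; [|split; [|split; [|split]]].
  - apply C2_01_of_is_derive; intros r Hr.
    destruct (HW _ (B r Hr)) as [A1 [A2 [A3 _]]]; split; [|split].
    + now apply is_derive_dilate.
    + now apply is_derive_Rscal, is_derive_dilate.
    + do 2 (apply Rcontinuous_mult; [apply continuous_const|]).
      apply (continuous_comp (fun r => rad * r) W2); [cont|exact A3].
  - intros r Hr; apply is_derive_Reals.
    destruct (HW (rad * r)) as [_ [_ [_ [A4 A5]]]]; [apply B; lra|].
    apply is_derive_ext with (fun s => rad ^ S n * (- W1 (rad * s)) ^ S n).
    { intros s; rewrite <- Rpow_mult_distr; f_equal; ring. }
    evar_last.
    { apply is_derive_Rscal.
      apply (is_derive_dilate (fun s => (- W1 s) ^ S n)); exact A4. }
    unfold h; rewrite (Rabs_pos_eq (W (rad * r))) by lra.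
    replace (S n - 1)%nat with n by lia.
    rewrite !Rpow_mult_distr, <- pow_mult, (Nat.mul_comm 2), pow_mult; simpl; ring.
  - rewrite Rmult_0_r, H1; ring.
  - rewrite Rmult_1_r; exact HR.
  - intros r Hr; apply HW'; nra.
Qed.

(** With a radius of at most 1, [W] would fall from 1 to 0 over a length of at most 1 and somewhere
    have slope at most -1, while the equation keeps [(- W1) ^ S n] at most [INR (S n) * eps < 1]. *)
Lemma profile_small_weight (n : nat) (h : R -> R) (eps : R) :
  admissible h -> INR (S n) * eps < 1 -> (forall s, 0 < s <= 1 -> h s <= eps) ->
  0 < profile n h 1.
Proof.
  intros Hh Heps Hle; apply Rnot_le_lt; intros Hneg.
  destruct (profile_radial_solution n h Hh) as [W [W1 [W2 [HW [HW' [H0 [H1 HR]]]]]]].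
  set (rad := exp (profile n h 1)) in *.
  assert (R0 : 0 < rad) by apply exp_pos.
  assert (R1 : rad <= 1).
  { rewrite <- exp_0; unfold rad; destruct Hneg as [L| ->]; [|apply Rle_refl].
    now apply Rlt_le, exp_increasing. }
  destruct (strict_mean_value W W1 0 rad) as [c [Hc E]]; [exact R0| |].
  { intros x Hx; now apply HW. }
  rewrite HR, H0 in E.
  assert (Hs : 1 <= - W1 c) by nra.
  destruct (strict_mean_value (fun s => (- W1 s) ^ S n)
              (fun s => INR (S n) * s ^ n * h (W s)) 0 c) as [d [Hd E2]]; [lra| |].
  { intros x Hx; apply HW; lra. }
  rewrite H1, Ropp_0, pow_i, 2!Rminus_0_r in E2 by lia.
  assert (P1 : 1 <= (- W1 c) ^ S n) by now apply pow_R1_Rle.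
  assert (A : 0 < W d <= 1) by (split; [apply HW'; lra|apply HW; lra]).
  assert (A1 := Hle _ A).
  assert (A0 : 0 < h (W d)) by now apply Hh.
  assert (Pd : 0 <= d ^ n <= 1).
  { split; [apply pow_le; lra|]; rewrite <- (pow1 n); apply pow_incr; lra. }
  assert (NS := pos_INR (S n)).
  assert (B1 : INR (S n) * d ^ n * h (W d) <= INR (S n) * eps).
  { rewrite Rmult_assoc; apply Rmult_le_compat_l; [exact NS|].
    apply Rle_trans with (1 * h (W d)); [apply Rmult_le_compat_r; lra|lra]. }
  assert (B0 : 0 <= INR (S n) * d ^ n * h (W d)).
  { repeat apply Rmult_le_pos; lra. }
  nra.
Qed.

(** * Shooting in the amplitude *)

Definition rescaled (n : nat) (g : R -> R) (lam a s : R) : R :=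
  g (a * s) * (lam ^ S n / a ^ S n).

Section Shooting.

Variables (n : nat) (g : R -> R) (finf lam lam1 : R).
Hypothesis g_continuous : forall s, continuous g s.
Hypothesis g_nonneg : forall s, 0 <= g s.
Hypothesis g_pos : forall s, 0 < s -> 0 < g s.
Hypothesis finf_pos : 0 < finf.
Hypothesis lam_pos : 0 < lam.
Hypothesis g_small : forall eps, 0 < eps -> exists delta, 0 < delta /\
  forall s, 0 < s < delta -> g s <= eps * s ^ S n.
Hypothesis g_large : forall eps, 0 < eps -> exists A, 0 < A /\
  forall s, A < s -> Rabs (g s - (finf * s) ^ S n) <= eps * s ^ S n.
Hypothesis lam1_eigen : first_eigenvalue (S n) lam1.
Hypothesis lam_large : lam1 < lam * finf.

Lemma rescaled_admissible (a : R) : 0 < a -> admissible (rescaled n g lam a).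
Proof.
  intros Ha.
  assert (Hc : 0 < lam ^ S n / a ^ S n) by (apply Rdiv_lt_0_compat; now apply pow_lt).
  split; [|split].
  - intros s; unfold rescaled; apply Rcontinuous_mult; [|apply continuous_const].
    apply (continuous_comp (fun s => a * s) g); [cont|apply g_continuous].
  - intros s; apply Rmult_le_pos; [apply g_nonneg|lra].
  - intros s Hs; apply Rmult_lt_0_compat; [apply g_pos; nra|exact Hc].
Qed.

Lemma rescaled_profile_continuous (a : R) :
  0 < a -> continuous (fun a => profile n (rescaled n g lam a) 1) a.
Proof.
  intros Ha; apply filterlim_locally; intros eps.
  destruct (profile_stable n _ eps (rescaled_admissible a Ha) (cond_pos eps))
    as [d [Hd Hst]].
  destruct (uniform_continuity_2d_1d' (rescaled n g lam) 0 1 a)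
    with (eps := mkposreal d Hd) as [eta Heta].
  { intros s _; unfold rescaled; apply continuity_2d_pt_mult.
    - apply (continuity_1d_2d_pt_comp g (fun a s => a * s)).
      + apply continuity_pt_filterlim, g_continuous.
      + apply continuity_2d_pt_mult;
          [apply continuity_2d_pt_id1|apply continuity_2d_pt_id2].
    - apply (continuity_1d_2d_pt_comp (fun a => lam ^ S n / a ^ S n) (fun a s => a)).
      + apply continuity_pt_filterlim.
        apply (Rcontinuous_mult (fun _ => lam ^ S n) (fun a => / a ^ S n));
          [apply continuous_const|].
        apply Rcontinuous_inv; [apply pow_nonzero; lra|cont].
      + apply continuity_2d_pt_id1. }
  (* Staying within [a] of [a] keeps [b] positive, so that the weight at [b] is admissible. *)
  exists (mkposreal (Rmin a eta) (Rmin_pos _ _ Ha (cond_pos eta))).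
  intros b Hb; change (Rabs (b - a) < Rmin a eta) in Hb.
  assert (Hb1 := Rlt_le_trans _ _ _ Hb (Rmin_l a eta)).
  assert (Hb2 := Rlt_le_trans _ _ _ Hb (Rmin_r a eta)).
  apply Rabs_def2 in Hb1; apply Rabs_def2 in Hb2.
  apply Hst; [apply rescaled_admissible; lra|].
  intros s Hs; apply Rlt_le, Heta; rewrite ?Rminus_diag, ?Rabs_R0;
    generalize (cond_pos eta); lra.
Qed.

Lemma rescaled_profile_small : exists a, 0 < a /\ 0 < profile n (rescaled n g lam a) 1.
Proof.
  assert (NS : 0 < INR (S n)) by (apply lt_0_INR; lia).
  assert (LS : 0 < lam ^ S n) by now apply pow_lt.
  (* This choice cancels [lam ^ S n] and bounds the rescaled weight by [/ (2 * INR (S n))], so that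
     the product in [profile_small_weight] is 1/2. *)
  destruct (g_small (/ (2 * INR (S n) * lam ^ S n))) as [d [Hd Hs]].
  { apply Rinv_0_lt_compat, Rmult_lt_0_compat; [lra|exact LS]. }
  assert (Ha : 0 < d / 2) by lra.
  assert (AS : 0 < (d / 2) ^ S n) by now apply pow_lt.
  exists (d / 2); split; [exact Ha|].
  apply profile_small_weight with (eps := / (2 * INR (S n))).
  - now apply rescaled_admissible.
  - replace (INR (S n) * / (2 * INR (S n))) with (/ 2) by (field; lra); lra.
  - intros s Hs1; unfold rescaled.
    assert (Hg : g (d / 2 * s) <= / (2 * INR (S n) * lam ^ S n) * (d / 2 * s) ^ S n)
      by (apply Hs; nra).
    assert (Hs2 : s ^ S n <= 1) by (rewrite <- (pow1 (S n)); apply pow_incr; lra).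
    apply Rle_trans with
      (/ (2 * INR (S n) * lam ^ S n) * (d / 2 * s) ^ S n * (lam ^ S n / (d / 2) ^ S n)).
    + apply Rmult_le_compat_r; [apply Rlt_le, Rdiv_lt_0_compat; lra|exact Hg].
    + rewrite Rpow_mult_distr.
      replace (/ (2 * INR (S n) * lam ^ S n) * ((d / 2) ^ S n * s ^ S n) *
               (lam ^ S n / (d / 2) ^ S n)) with (/ (2 * INR (S n)) * s ^ S n)
        by (field; repeat split; lra).
      rewrite <- (Rmult_1_r (/ (2 * INR (S n)))) at 2.
      apply Rmult_le_compat_l; [apply Rlt_le, Rinv_0_lt_compat; lra|exact Hs2].
Qed.

(** For the limit weight, a radius of at least 1 would force [lam1 >= mu] by [eigenvalue_profile].
    So its profile is negative at 1, and [profile_stable] with tolerance [- profile n h 1] carries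
    the sign over to large amplitudes. *)
Lemma rescaled_profile_large (a0 : R) :
  exists a, a0 < a /\ 0 < a /\ profile n (rescaled n g lam a) 1 < 0.
Proof.
  set (mu := lam * finf).
  assert (Hmu : 0 < mu) by now apply Rmult_lt_0_compat.
  set (h := fun s => (mu * Rabs s) ^ S n).
  assert (Hh : admissible h) by now apply power_weight_admissible.
  assert (Hneg : profile n h 1 < 0).
  { apply Rnot_le_lt; intros Hle.
    assert (E := eigenvalue_profile n mu lam1 Hmu lam1_eigen); fold h in E.
    assert (1 <= exp (profile n h 1)).
    { generalize (profile n h 1) Hle; intros q Hq.
      rewrite <- exp_0; destruct Hq as [L| <-]; [|apply Rle_refl].
      now apply Rlt_le, exp_increasing. }
    assert (1 <= exp (profile n h 1) ^ 2) by now apply pow_R1_Rle.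
    assert (lam1 < mu) by exact lam_large; nra. }
  destruct (profile_stable n h (- profile n h 1) Hh) as [d [Hd Hst]]; [lra|].
  assert (LS : 0 < lam ^ S n) by now apply pow_lt.
  destruct (g_large (d / (2 * lam ^ S n))) as [A [HA Hl]].
  { apply Rdiv_lt_0_compat; lra. }
  destruct (continuity_ab_maj (fun s => Rabs (g s - (finf * s) ^ S n)) 0 A)
    as [sB [HB _]]; [lra| |].
  { intros s _; apply continuity_pt_filterlim.
    apply (continuous_Rabs_comp (fun s => g s - (finf * s) ^ S n)).
    assert (Cs := g_continuous s); cont. }
  set (B := Rabs (g sB - (finf * sB) ^ S n)) in *.
  assert (B0 : 0 <= B) by apply Rabs_pos.
  assert (C0 : 0 <= 2 * lam ^ S n * B / d).
  { apply Rmult_le_pos; [apply Rmult_le_pos; lra|].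
    apply Rlt_le, Rinv_0_lt_compat, Hd. }
  (* Chosen so that the error [lam ^ S n * B / a ^ S n] is at most [d / 2] once [a ^ S n >= C]. *)
  set (C := 2 * lam ^ S n * B / d) in *.
  (* The summand 1 gives [a >= 1], hence [a ^ S n >= a >= C]; [Rabs a0] puts [a] beyond [a0]. *)
  set (a := 1 + Rabs a0 + C).
  assert (Ha : a0 < a /\ 1 <= a /\ C <= a)
    by (unfold a; generalize (Rle_abs a0) (Rabs_pos a0); lra).
  exists a; split; [lra|split; [lra|]].
  assert (AS : C <= a ^ S n).
  { simpl; assert (1 <= a ^ n) by (apply pow_R1_Rle; lra); nra. }
  assert (AS0 : 0 < a ^ S n) by (apply pow_lt; lra).
  assert (Hlt : Rabs (profile n (rescaled n g lam a) 1 - profile n h 1) < - profile n h 1).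
  { apply Hst; [apply rescaled_admissible; lra|].
    intros s Hs; unfold rescaled, h, mu.
    rewrite (Rabs_pos_eq s) by lra.
    replace (g (a * s) * (lam ^ S n / a ^ S n) - (lam * finf * s) ^ S n)
      with ((lam ^ S n / a ^ S n) * (g (a * s) - (finf * (a * s)) ^ S n)).
    2:{ rewrite !Rpow_mult_distr; field; lra. }
    assert (Q0 : 0 < lam ^ S n / a ^ S n) by now apply Rdiv_lt_0_compat.
    rewrite Rabs_mult, Rabs_pos_eq by lra.
    assert (Hs0 : 0 <= s ^ S n) by (apply pow_le; lra).
    assert (Hs1 : s ^ S n <= 1) by (rewrite <- (pow1 (S n)); apply pow_incr; lra).
    (* For [a * s <= A] the asymptotics say nothing and compactness supplies [B]; beyond [A] the
       error is a small multiple of [(a * s) ^ S n], hence of [a ^ S n]. *)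
    assert (Hb : Rabs (g (a * s) - (finf * (a * s)) ^ S n) <=
                 B + d / (2 * lam ^ S n) * a ^ S n).
    { assert (D0 : 0 < d / (2 * lam ^ S n)) by (apply Rdiv_lt_0_compat; lra).
      assert (Has : 0 <= a * s) by (apply Rmult_le_pos; lra).
      destruct (Rle_or_lt (a * s) A) as [L|L].
      - apply Rle_trans with B; [now apply HB|].
        assert (0 <= d / (2 * lam ^ S n) * a ^ S n) by (apply Rmult_le_pos; lra).
        lra.
      - apply Rle_trans with (1 := Hl _ L).
        rewrite Rpow_mult_distr.
        apply Rle_trans with (d / (2 * lam ^ S n) * a ^ S n); [|lra].
        apply Rmult_le_compat_l; [lra|].
        rewrite <- (Rmult_1_r (a ^ S n)) at 2; apply Rmult_le_compat_l; lra. }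
    apply Rle_trans with (lam ^ S n / a ^ S n * (B + d / (2 * lam ^ S n) * a ^ S n)).
    { apply Rmult_le_compat_l; lra. }
    replace (lam ^ S n / a ^ S n * (B + d / (2 * lam ^ S n) * a ^ S n))
      with (d / 2 * (C / a ^ S n) + d / 2) by (unfold C; field; lra).
    assert (C / a ^ S n <= 1).
    { apply Rmult_le_reg_r with (a ^ S n); [exact AS0|].
      replace (C / a ^ S n * a ^ S n) with C by (field; lra); lra. }
    nra. }
  apply Rabs_def2 in Hlt; lra.
Qed.

Lemma shooting :
  exists a W W1 W2, 0 < a /\ radial_solution n (rescaled n g lam a) 1 W W1 W2.
Proof.
  destruct rescaled_profile_small as [a0 [Ha0 H0]].
  destruct (rescaled_profile_large a0) as [a1 [Ha01 [Ha1 H1]]].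
  (* The minus sign orients the function from negative to positive; at its zero the radius is
     [exp 0 = 1]. *)
  destruct (IVT_interv (fun a => - profile n (rescaled n g lam a) 1) a0 a1)
    as [a [Ha E]]; [|exact Ha01|lra|lra|].
  { intros a Ha; apply continuity_pt_filterlim.
    apply (Rcontinuous_opp (fun a => profile n (rescaled n g lam a) 1)).
    apply rescaled_profile_continuous; lra. }
  assert (Hap : 0 < a) by lra.
  destruct (profile_radial_solution n _ (rescaled_admissible a Hap)) as [W [W1 [W2 HW]]].
  exists a, W, W1, W2; split; [exact Hap|].
  replace (profile n (rescaled n g lam a) 1) with 0 in HW by lra.
  now rewrite exp_0 in HW.
Qed.

End Shooting.

(** * Solutions of either sign *)

Lemma signed_solution (n : nat) (f : R -> R) (finf lam1 lam sigma : R) :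
  sigma ^ 2 = 1 ->
  continuity f ->
  (forall s, s <> 0 -> 0 < f s * s ^ S n) ->
  lim_at_0_ratio (S n) f 0 ->
  0 < finf ->
  lim_at_inf_ratio (S n) f (finf ^ S n) ->
  first_eigenvalue (S n) lam1 ->
  lam1 / finf < lam ->
  exists w w1 w2,
    solves_MO (S n) f lam (fun r => - sigma * w r) /\
    (forall r, 0 < r < 1 -> 0 < w r) /\
    (forall r, 0 < r < 1 ->
       is_derive w r (w1 r) /\ is_derive w1 r (w2 r) /\ w2 r < 0).
Proof.
  intros Hsig fc fpos f0 finf_pos finfty Heig Hlam.
  assert (Habs : Rabs sigma = 1).
  { rewrite <- (Rabs_pos_eq 1) by lra; apply Rsqr_eq_abs_0; unfold Rsqr; nra. }
  assert (Hsp : sigma ^ S n * sigma ^ S n = 1).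
  { rewrite <- Rpow_mult_distr; replace (sigma * sigma) with 1 by nra; apply pow1. }
  assert (Hs0 : forall s, 0 < s -> sigma * s <> 0) by (intros s Hs E; nra).
  assert (Hpow : forall s, (sigma * s) ^ S n = sigma ^ S n * s ^ S n)
    by (intros; apply Rpow_mult_distr).
  (* For [s > 0], (f1) gives [f (sigma * s)] the sign of [sigma ^ S n], so the absolute value
     amounts to multiplication by [sigma ^ S n]. The ratio of [g] at [s] then equals that of [f] at
     [sigma * s], and one shooting argument serves both signs. *)
  set (g := fun s => Rabs (f (sigma * s))).
  assert (Hg : forall s, 0 < s -> g s = sigma ^ S n * f (sigma * s)).
  { intros s Hs; assert (A := fpos _ (Hs0 s Hs)); rewrite Hpow in A.
    assert (Hsn : 0 < s ^ S n) by now apply pow_lt.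
    assert (A2 : 0 < sigma ^ S n * f (sigma * s)) by nra.
    unfold g; rewrite <- (Rabs_pos_eq (sigma ^ S n * f (sigma * s))) by lra.
    rewrite Rabs_mult, <- RPow_abs, Habs, pow1; ring. }
  assert (Hratio : forall s, 0 < s -> f (sigma * s) / (sigma * s) ^ S n = g s / s ^ S n).
  { intros s Hs; rewrite Hg, Hpow by exact Hs.
    assert (Hsn : 0 < s ^ S n) by now apply pow_lt.
    assert (sigma ^ S n <> 0) by (intros E; rewrite E in Hsp; lra).
    rewrite <- (Rmult_1_l (f (sigma * s))) at 1; rewrite <- Hsp; field; split; lra. }
  assert (lam_pos : 0 < lam).
  { apply Rlt_trans with (2 := Hlam), Rdiv_lt_0_compat; [apply Heig|exact finf_pos]. }
  destruct (shooting n g finf lam lam1) as [a [W [W1 [W2 [Ha [HW [HW' [H0 [H1 HR]]]]]]]]].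
  - intros s; apply continuous_Rabs_comp.
    apply (continuous_comp (fun s => sigma * s) f); [cont|].
    apply continuity_pt_filterlim, fc.
  - intros s; apply Rabs_pos.
  - intros s Hs; apply Rabs_pos_lt; intros E.
    generalize (fpos _ (Hs0 s Hs)); rewrite E; lra.
  - exact finf_pos.
  - exact lam_pos.
  - intros eps Heps; destruct (f0 eps Heps) as [d [Hd Hf]].
    exists d; split; [exact Hd|]; intros s Hs.
    assert (A := Hf (sigma * s) (Hs0 s (proj1 Hs))).
    rewrite Rabs_mult, Habs, Rabs_pos_eq, Rmult_1_l, Hratio in A by lra.
    specialize (A (proj2 Hs)); apply Rabs_def2 in A.
    assert (Hsn : 0 < s ^ S n) by (apply pow_lt; lra).
    replace (g s) with (g s / s ^ S n * s ^ S n) by (field; lra); nra.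
  - intros eps Heps; destruct (finfty eps Heps) as [A [HA Hf]].
    exists A; split; [exact HA|]; intros s Hs.
    assert (E := Hf (sigma * s)).
    rewrite Rabs_mult, Habs, Rabs_pos_eq, Rmult_1_l, Hratio in E by lra.
    specialize (E Hs).
    assert (Hsn : 0 < s ^ S n) by (apply pow_lt; lra).
    replace (g s - (finf * s) ^ S n) with ((g s / s ^ S n - finf ^ S n) * s ^ S n)
      by (rewrite Rpow_mult_distr; field; lra).
    rewrite Rabs_mult, (Rabs_pos_eq (s ^ S n)) by lra.
    apply Rmult_le_compat_r; lra.
  - exact Heig.
  - apply Rmult_lt_compat_r with (r := finf) in Hlam; [|exact finf_pos].
    now replace (lam1 / finf * finf) with lam1 in Hlam by (field; lra).
  - exists (fun r => a * W r), (fun r => a * W1 r), (fun r => a * W2 r).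
    split; [|split].
    + exists (fun r => - sigma * (a * W1 r)), (fun r => - sigma * (a * W2 r)).
      split; [|split; [|split]].
      * apply C2_01_of_is_derive; intros r Hr.
        destruct (HW r Hr) as [A1 [A2 [A3 _]]].
        split; [|split].
        -- now apply (is_derive_Rscal (fun r => a * W r)), is_derive_Rscal.
        -- now apply (is_derive_Rscal (fun r => a * W1 r)), is_derive_Rscal.
        -- cont.
      * intros r Hr; apply is_derive_Reals.
        destruct (HW r) as [_ [_ [_ [A4 _]]]]; [lra|].
        (* Here [u' = sigma * a * (- W1)] and [- u = sigma * a * W]. The [sigma ^ S n] from the
           power meets the one in [g], with product 1, and [a ^ S n] cancels against the
           normalisation in [rescaled]. *)
        apply is_derive_ext with (fun s => (sigma * a) ^ S n * (- W1 s) ^ S n).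
        { intros s; rewrite <- Rpow_mult_distr; f_equal; ring. }
        evar_last; [apply is_derive_Rscal; exact A4|].
        assert (HWr : 0 < a * W r) by (apply Rmult_lt_0_compat; [|apply HW']; lra).
        unfold rescaled; rewrite Hg by exact HWr.
        replace (- (- sigma * (a * W r))) with (sigma * (a * W r)) by ring.
        replace (S n - 1)%nat with n by lia.
        assert (Han : a ^ S n <> 0) by (apply pow_nonzero; lra).
        rewrite Rpow_mult_distr.
        replace (sigma ^ S n * a ^ S n * (INR (S n) * r ^ n *
                   (sigma ^ S n * f (sigma * (a * W r)) * (lam ^ S n / a ^ S n))))
          with ((sigma ^ S n * sigma ^ S n) *
                (lam ^ S n * INR (S n) * r ^ n * f (sigma * (a * W r)))) by (field; exact Han).
        rewrite Hsp; ring.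
      * rewrite H1; ring.
      * rewrite HR; ring.
    + intros r Hr; apply Rmult_lt_0_compat; [exact Ha|now apply HW'].
    + intros r Hr; destruct (HW r) as [A1 [A2 _]]; [lra|].
      split; [now apply is_derive_Rscal|split; [now apply is_derive_Rscal|]].
      generalize (proj2 (HW' r Hr)); nra.
Qed.

Theorem theorem4p4 (N : nat) (f : R -> R) (finf lam1 : R) :
  (1 <= N)%nat ->
  continuity f ->
  (forall s, s <> 0 -> 0 < f s * s ^ N) ->
  lim_at_0_ratio N f 0 ->
  0 < finf ->
  lim_at_inf_ratio N f (finf ^ N) ->
  first_eigenvalue N lam1 ->
  forall lam, lam1 / finf < lam ->
    (exists u, solves_MO N f lam u /\
       (forall r, 0 < r < 1 -> 0 < u r) /\ strictly_concave01 u) /\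
    (exists u, solves_MO N f lam u /\
       (forall r, 0 < r < 1 -> u r < 0) /\ strictly_convex01 u).
Proof.
  intros HN fc fpos f0 finf_pos finfty Heig lam Hlam.
  destruct N as [|n]; [lia|].
  split.
  (* Since [u = - sigma * w] with [w] positive, [sigma = -1] yields the positive solution and
     [sigma = 1] the negative one. *)
  - destruct (signed_solution n f finf lam1 lam (-1)) as [w [w1 [w2 [Hsol [Hpos Hd]]]]];
      auto; [ring|].
    exists (fun r => - (-1) * w r); split; [exact Hsol|split].
    + intros r Hr; generalize (Hpos r Hr); lra.
    + apply strictly_concave_of_second_derivative
        with (u1 := fun r => - (-1) * w1 r) (u2 := fun r => - (-1) * w2 r).
      intros r Hr; destruct (Hd r Hr) as [D1 [D2 D3]].
      split; [now apply is_derive_Rscal|split; [now apply is_derive_Rscal|lra]].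
  - destruct (signed_solution n f finf lam1 lam 1) as [w [w1 [w2 [Hsol [Hpos Hd]]]]];
      auto; [ring|].
    exists (fun r => - 1 * w r); split; [exact Hsol|split].
    + intros r Hr; generalize (Hpos r Hr); lra.
    + apply strictly_convex_of_second_derivative
        with (u1 := fun r => - 1 * w1 r) (u2 := fun r => - 1 * w2 r).
      intros r Hr; destruct (Hd r Hr) as [D1 [D2 D3]].
      split; [now apply is_derive_Rscal|split; [now apply is_derive_Rscal|lra]].
Qed.
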